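(* Let $X$ be a (real) Banach space. The following properties are equivalent. (a) $X$ is a Gurariĭ space. (b) $X$ has a skeleton consisting of subspaces linearly isometric to the separable Gurariĭ space $\mathbb{G}$. (c) There exists a directed family $\mathcal{G}$ of (closed linear) subspaces of $X$, each linearly isometric to $\mathbb{G}$, such that $\bigcup\mathcal{G} = X$.
   Context: All Banach spaces are real. For $\varepsilon>0$, a linear operator $f\colon X\to Y$ between Banach spaces is an $\varepsilon$-isometric embedding if $(1+\varepsilon)^{-1}\|x\|\leq\|f(x)\|\leq(1+\varepsilon)\|x\|$ for every $x\in X\setminus\{0\}$; isometric embeddings are always linear. A Banach space $X$ is Gurariĭ if for every pair of finite-dimensional Banach spaces $S\subseteq T$, every isometric embedding $f\colon S\to X$ and every $\varepsilon>0$, there exists an $\varepsilon$-isometric embedding $g\colon T\to X$ with $g\restriction S=f$. There is a separable Gurariĭ space, unique up to linear isometry; it is denoted by $\mathbb{G}$. A family $\mathcal{F}$ of closed linear subspaces of a Banach space $X$ is a skeleton in $X$ if: (1) each $F\in\mathcal{F}$ is separable; (2) $\bigcup\mathcal{F}=X$; (3) for every $F_0,F_1\in\mathcal{F}$ there exists $G\in\mathcal{F}$ such that $F_0\cup F_1\subseteq G$; (4) $\operatorname{cl}(\bigcup_{n\in\omega}F_n)\in\mathcal{F}$ whenever $\{F_n\}_{n\in\omega}$ is a countable chain in $\mathcal{F}$ (i.e. $F_0\subseteq F_1\subseteq\cdots$). A family satisfying (3) is called directed. *)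

(* Defs.v *)
From HB Require Import structures.
From mathcomp Require Import all_boot all_order all_algebra.
From mathcomp Require Import all_classical all_reals all_analysis.
Import Order.TTheory GRing.Theory Num.Theory.
Import numFieldNormedType.Exports.

Set Implicit Arguments.
Unset Strict Implicit.
Unset Printing Implicit Defensive.

Local Open Scope classical_set_scope.
Local Open Scope ring_scope.

(* Real Banach spaces are the [completeNormedModType R] with [R : realType];
   subspaces of a space [V] are sets [F : set V]. *)

Definition linear_subspace (R : realType) (V : lmodType R) (F : set V) : Prop :=
  submod_closed (mem F).

Definition closed_subspace (R : realType) (V : normedModType R) (F : set V) :
    Prop :=
  linear_subspace F /\ closed F.

Definition separable_set (V : topologicalType) (A : set V) : Prop :=
  exists D : set V, [/\ countable D, D `<=` A & A `<=` closure D].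

Definition finite_dimensional (R : realType) (V : lmodType R) : Prop :=
  exists (n : nat) (e : 'I_n -> V),
    forall x : V, exists c : 'I_n -> R, x = \sum_(i < n) c i *: e i.

(* A map on a subspace [S] of [V] is encoded as a total function on [V] of
   which only the values on [S] are constrained. *)
Definition isometric_embedding_on (R : realType) (V W : normedModType R)
    (S : set V) (f : V -> W) : Prop :=
  (forall a : R, {in S &, forall u v, f (a *: u + v) = a *: f u + f v}) /\
  {in S, forall u, `|f u| = `|u|}.

Definition eps_isometric_embedding (R : realType) (V W : normedModType R)
    (eps : R) (f : {linear V -> W}) : Prop :=
  forall x : V, x != 0 ->
    (1 + eps)^-1 * `|x| <= `|f x| /\ `|f x| <= (1 + eps) * `|x|.

Definition gurarii (R : realType) (X : completeNormedModType R) : Prop :=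
  forall (T : completeNormedModType R) (S : set T) (f : T -> X) (eps : R),
    finite_dimensional T -> linear_subspace S ->
    isometric_embedding_on S f -> 0 < eps ->
    exists g : {linear T -> X},
      eps_isometric_embedding eps g /\ {in S, g =1 f}.

Definition linearly_isometric_to (R : realType) (V G : normedModType R)
    (F : set V) : Prop :=
  exists u : G -> V, isometric_embedding_on [set: G] u /\ range u = F.
Arguments linearly_isometric_to {R V} G F.

Definition directed (T : Type) (Fam : set (set T)) : Prop :=
  forall F0 F1, Fam F0 -> Fam F1 -> exists2 H, Fam H & F0 `|` F1 `<=` H.

Definition covers (T : Type) (Fam : set (set T)) : Prop :=
  \bigcup_(F in Fam) F = [set: T].

Definition skeleton (R : realType) (X : completeNormedModType R)
    (Fam : set (set X)) : Prop :=
  [/\ forall F, Fam F -> closed_subspace F,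
      forall F, Fam F -> separable_set F,
      covers Fam,
      directed Fam &
      forall F : nat -> set X, (forall n, Fam (F n)) ->
        (forall n, F n `<=` F n.+1) -> Fam (closure (\bigcup_n F n))].

(* Main.v *)
Require Import Defs.
From HB Require Import structures.
From mathcomp Require Import all_boot all_order all_algebra.
From mathcomp Require Import all_classical all_reals all_analysis.
From mathcomp Require Import ring lra.
Import Order.TTheory GRing.Theory Num.Theory.
Import numFieldNormedType.Exports.
Set Implicit Arguments.
Unset Strict Implicit.
Unset Printing Implicit Defensive.
Local Open Scope classical_set_scope.
Local Open Scope ring_scope.

(** Everything rests on a relative form of the Gurarii property: a subspace [U]
of [X] satisfies [gurarii_in U] when isometric embeddings of finite-dimensional
spaces into [U] have almost isometric extensions that still take values in [U].
Here [U] need not be closed, which is what makes the two main lemmas fit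
together.

The first, [directed_gurarii_in], says that the union of a directed family of
isometric copies of [G] has the property. A linear map from a finite-dimensional
space into a directed union of subspaces takes its values in one member
([directed_absorbs]), and that member inherits the property from [G]. When the
family covers [X], this is the implication from (c) to (a).

The second, [gurarii_isometry_absorbing], strengthens the uniqueness of the
separable Gurarii space: if [U] is a subspace with the property and [C] is a
countable part of [U], there is a linear isometry from [G] into the closure of
[U] whose (closed) range contains [C]. Taking [U = X], every countable part of a
Gurarii space [X] lies in a closed subspace isometric to [G]; hence the family of
all closed subspaces isometric to [G] covers [X] and is directed. Taking for [U]
the union of a chain of such subspaces, and for [C] a countable dense part of
it, the closure of the union is again isometric to [G]. So that family is a
skeleton, which is the implication from (a) to (b).

The second lemma is proved by back and forth, following Kubis and Solecki. One
builds finite families [x] in [G] and [y] in [U] such that the linear map sending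
[x i] to [y i] is an almost isometry, with errors that tend geometrically to 0.
The step is a correction ([gurarii_in_correct]): given an almost isometric
correspondence with error [eps], one can move [y] by a relative amount of about
[eps], and at the same time extend it to match new vectors of [x], so as to make
the error as small as desired. To do so, the spans of [x] and [y] are glued into
a finite-dimensional space in which corresponding vectors are [eps]-close
([amalgam]), and the Gurarii property is applied to the copy of the span of [y]
inside it. Since the successive movements are summable, the families converge,
the limit correspondence is isometric, and [extend_isometry] extends it to the
closures of the spans. *)

(** * Finite-dimensional normed spaces as norms on row vectors *)

Record row_norm (R : realType) (n : nat) := RowNorm {
  row_norm_fun :> 'rV[R]_n -> R;
  row_normD : forall u v,
    row_norm_fun (u + v) <= row_norm_fun u + row_norm_fun v;
  row_normZ : forall a u, row_norm_fun (a *: u) = `|a| * row_norm_fun u;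
  row_norm_eq0 : forall u, row_norm_fun u = 0 -> u = 0 }.

Section RowNorm.
Context (R : realType) (n : nat) (N : row_norm R n).

Lemma row_norm0 : N 0 = 0.
Proof. by rewrite -(scale0r 0) row_normZ normr0 mul0r. Qed.

Lemma row_normN u : N (- u) = N u.
Proof. by rewrite -scaleN1r row_normZ normrN1 mul1r. Qed.

Lemma row_norm_ge0 u : 0 <= N u.
Proof.
have := row_normD N u (- u); rewrite subrr row_norm0 row_normN.
by rewrite -mulr2n pmulrn_lge0.
Qed.

Lemma row_norm_sum (I : Type) (s : seq I) (F : I -> 'rV[R]_n) :
  N (\sum_(i <- s) F i) <= \sum_(i <- s) N (F i).
Proof.
elim/big_rec2 : _ => [|i y x _ le_xy]; first by rewrite row_norm0.
by apply: (le_trans (row_normD _ _ _)); rewrite lerD2l.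
Qed.

Lemma row_norm_le : exists2 C, 0 < C & forall u, N u <= C * `|u|.
Proof.
exists (1 + \sum_(j < n) N (delta_mx 0 j)).
  by rewrite ltr_pwDl// sumr_ge0// => j _; exact: row_norm_ge0.
move=> u; rewrite {1}(row_sum_delta u).
apply: (le_trans (row_norm_sum _ _)).
rewrite mulrDl mul1r ler_wpDl// mulr_suml ler_sum// => j _.
rewrite row_normZ mulrC ler_wpM2l ?row_norm_ge0//.
rewrite [leRHS]/Num.norm/= mx_normrE.
exact: (le_bigmax _ (fun i => `|u i.1 i.2|) (0, j)).
Qed.

Lemma row_norm_dist u v : `|N u - N v| <= N (u - v).
Proof.
rewrite ler_norml; apply/andP; split.
  have := row_normD N (v - u) u; rewrite subrK -(row_normN (u - v)) opprB; lra.
by have := row_normD N (u - v) v; rewrite subrK; lra.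
Qed.

Lemma row_norm_continuous : continuous N.
Proof.
have [C C0 NC] := row_norm_le.
move=> u; apply/(@cvgrPdist_lt _ _ _ _ (nbhs_filter u)) => e e0; near=> v.
apply: le_lt_trans (row_norm_dist _ _) _; apply: le_lt_trans (NC _) _.
rewrite -ltr_pdivlMl//.
near: v; rewrite -nbhs_nbhs_norm; exists (C^-1 * e) => //=.
by rewrite mulr_gt0// invr_gt0.
Unshelve. all: by end_near. Qed.

(** The norm attains a positive minimum on the unit sphere of the sup norm, which
is compact. With [row_norm_le] this makes all norms on row vectors equivalent,
hence complete. *)
Lemma row_norm_ge : exists2 c, 0 < c & forall u, c * `|u| <= N u.
Proof.
pose S := [set u : 'rV[R]_n | `|u| = 1].
have Sc : compact S.
  apply: bounded_closed_compact.
    exists 1; split; first by rewrite num_real.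
    by move=> x x1 u /= ->; exact: ltW.
  rewrite (_ : S = (fun u => `|u|) @^-1` [set 1])//.
  by apply: closed_comp => [u _|]; [exact: norm_continuous|exact: closed_eq].
have [S0|/set0P S0] := eqVneq S set0.
  exists 1 => // u; have [->|u0] := eqVneq u 0.
    by rewrite normr0 mulr0 row_norm_ge0.
  have : S (`|u|^-1 *: u).
    by rewrite /S/= normrZ normfV normr_id mulVf// normr_eq0.
  by rewrite S0.
have [u0 u0S u0min] :=
  compact_EVT_min S0 Sc (continuous_subspaceT row_norm_continuous).
exists (N u0).
  rewrite lt_neqAle row_norm_ge0 andbT eq_sym; apply/eqP => /row_norm_eq0 u00.
  by move: u0S; rewrite u00 inE /S/= normr0 => /eqP; rewrite eq_sym oner_eq0.
move=> u; have [->|un0] := eqVneq u 0.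
  by rewrite normr0 mulr0 row_norm_ge0.
have nu : 0 < `|u| by rewrite normr_gt0.
have : N u0 <= N (`|u|^-1 *: u).
  apply: u0min; rewrite inE /S/= normrZ normfV normr_id mulVf//.
  by rewrite gt_eqF.
by rewrite row_normZ normfV normr_id ler_pdivlMl// mulrC.
Qed.

End RowNorm.

(** A copy of the row vectors, so that [N] does not compete with the sup norm
that row vectors already carry. *)
Definition normed_row (R : realType) (n : nat) (N : row_norm R n) := 'rV[R]_n.

HB.instance Definition _ (R : realType) (n : nat) (N : row_norm R n) :=
  GRing.Lmodule.copy (normed_row N) 'rV[R]_n.
HB.instance Definition _ (R : realType) (n : nat) (N : row_norm R n) :=
  Lmodule_isNormed.Build R (normed_row N)
    (row_normD N) (row_normZ N) (@row_norm_eq0 _ _ N).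

Lemma normed_row_complete (R : realType) (n : nat) (N : row_norm R n)
    (F : set_system (normed_row N)) : ProperFilter F -> cauchy F -> cvg F.
Proof.
move=> FF /cauchy_ballP Fc.
have [C C0 NC] := row_norm_le N; have [c c0 Nc] := row_norm_ge N.
have F'F : ProperFilter (F : set_system 'rV[R]_n) := FF.
have F'c : cauchy (F : set_system 'rV[R]_n).
  apply/cauchy_ballP => e e0; have ce0 : 0 < c * e by rewrite mulr_gt0.
  apply: filterS (Fc _ ce0) => -[u v]; rewrite -!ball_normE /= => uv.
  by rewrite -(ltr_pM2l c0); apply: le_lt_trans (Nc _) uv.
have /cvg_ex[l Fl] : cvg (F : set_system 'rV[R]_n) by exact: cauchy_cvg.
apply/cvg_ex; exists (l : normed_row N).
apply/cvgrPdist_lt => e e0.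
have Ce0 : 0 < C^-1 * e by rewrite mulr_gt0 ?invr_gt0.
move/cvgrPdist_lt : Fl => /(_ _ Ce0); apply: filterS => u /= lu.
by apply: le_lt_trans (NC _) _; rewrite -ltr_pdivlMl.
Qed.

HB.instance Definition _ (R : realType) (n : nat) (N : row_norm R n) :=
  Uniform_isComplete.Build (normed_row N) (@normed_row_complete R n N).

Lemma normed_row_finite_dimensional (R : realType) (n : nat)
  (N : row_norm R n) : finite_dimensional (normed_row N).
Proof.
exists n, (fun i => delta_mx 0 i) => x; exists (fun i => (x : 'rV_n) 0 i).
exact: (row_sum_delta (x : 'rV_n)).
Qed.

(** * Amalgamating two norms along an almost isometry *)

Section Amalgamation.
Context (R : realType) (n m : nat) (p : row_norm R n) (q : row_norm R m).
Context (L : {linear 'rV[R]_n -> 'rV[R]_m}) (eps : R).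
Context (eps0 : 0 < eps).
Context (Leps : forall w, `|q (L w) - p w| <= eps * p w).

(** The amalgam is the sum of the two spaces, in which a pair [(u, v)] may be
rewritten as [(u - w, v + L w)] at the price [eps * p w]. Its norm is the least
cost over all such rewritings; it is the largest norm that restricts to norms at
most [p] and [q] on the summands and for which [w] and [L w] are at distance at
most [eps * p w]. *)
Definition amalgam_cost (z : 'rV[R]_(n + m)) (w : 'rV[R]_n) : R :=
  p (lsubmx z - w) + q (rsubmx z + L w) + eps * p w.

Definition amalgam_fun (z : 'rV[R]_(n + m)) : R :=
  inf (range (amalgam_cost z)).

Lemma amalgam_cost_ge0 z w : 0 <= amalgam_cost z w.
Proof.
have := row_norm_ge0 p (lsubmx z - w); have := row_norm_ge0 q (rsubmx z + L w).
have := mulr_ge0 (ltW eps0) (row_norm_ge0 p w); rewrite /amalgam_cost; lra.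
Qed.

Lemma amalgam_le z w : amalgam_fun z <= amalgam_cost z w.
Proof.
apply: ge_inf; last by exists w.
by exists 0 => _ [v _ <-]; exact: amalgam_cost_ge0.
Qed.

Lemma amalgam_ge z c : (forall w, c <= amalgam_cost z w) -> c <= amalgam_fun z.
Proof.
move=> cz; apply: lb_le_inf; first by exists (amalgam_cost z 0), 0.
by move=> _ [w _ <-].
Qed.

Lemma amalgam_lt z c : amalgam_fun z < c -> exists w, amalgam_cost z w < c.
Proof.
by move=> /inf_lt[|_ [w _ <-]]; [exists (amalgam_cost z 0), 0|exists w].
Qed.

Lemma amalgamD u v : amalgam_fun (u + v) <= amalgam_fun u + amalgam_fun v.
Proof.
apply/ler_addgt0Pr => e e0; have e20 : 0 < e / 2 by lra.
have [w1] : exists w, amalgam_cost u w < amalgam_fun u + e / 2.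
  by apply: amalgam_lt; rewrite ltrDl.
have [w2] : exists w, amalgam_cost v w < amalgam_fun v + e / 2.
  by apply: amalgam_lt; rewrite ltrDl.
have := amalgam_le (u + v) (w1 + w2).
rewrite /amalgam_cost !linearD/= addrACA (addrACA (rsubmx u)).
have := row_normD p (lsubmx u - w1) (lsubmx v - w2).
have := row_normD q (rsubmx u + L w1) (rsubmx v + L w2).
have := ler_wpM2l (ltW eps0) (row_normD p w1 w2); lra.
Qed.

Lemma amalgam_costZ a z w :
  amalgam_cost (a *: z) (a *: w) = `|a| * amalgam_cost z w.
Proof.
rewrite /amalgam_cost !linearZ/= -!scalerDr !row_normZ !mulrDr.
by rewrite (mulrCA eps).
Qed.

Lemma amalgamZ a z : amalgam_fun (a *: z) = `|a| * amalgam_fun z.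
Proof.
have le_scale b y : b != 0 -> amalgam_fun (b *: y) <= `|b| * amalgam_fun y.
  move=> b0; rewrite -ler_pdivrMl ?normr_gt0//; apply: amalgam_ge => w.
  by rewrite ler_pdivrMl ?normr_gt0// -amalgam_costZ amalgam_le.
have [->|a0] := eqVneq a 0; last first.
  apply/eqP; rewrite eq_le le_scale//= -ler_pdivlMl ?normr_gt0// -normfV.
  by rewrite -{1}(scalerK a0 z) le_scale ?invr_eq0.
rewrite normr0 mul0r scale0r; apply/eqP; rewrite eq_le.
rewrite amalgam_ge ?andbT; last by move=> w; exact: amalgam_cost_ge0.
apply: (le_trans (amalgam_le 0 0)).
by rewrite /amalgam_cost !linear0 !addr0 !row_norm0 mulr0 !addr0.
Qed.

(** A small cost forces [w] to be small, because [eps] is positive, and then both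
components of [z] are small. *)
Lemma amalgam_eq0 z : amalgam_fun z = 0 -> z = 0.
Proof.
move=> z0; pose C := 1 + eps^-1 * (1 + eps).
have eV : 0 < eps^-1 by rewrite invr_gt0.
have small e : 0 < e -> p (lsubmx z) <= C * e /\ q (rsubmx z) <= C * e.
  move=> e0; have [w] : exists w, amalgam_cost z w < e.
    by apply: amalgam_lt; rewrite z0.
  rewrite /amalgam_cost => wlt.
  have p1 := row_norm_ge0 p (lsubmx z - w).
  have q1 := row_norm_ge0 q (rsubmx z + L w).
  have w1 := row_norm_ge0 p w.
  have ew := mulr_ge0 (ltW eps0) w1.
  have pw : p w <= eps^-1 * e by rewrite ler_pdivlMl//; lra.
  have := row_normD p (lsubmx z - w) w; rewrite subrK.
  have := row_normD q (rsubmx z + L w) (- L w); rewrite addrK row_normN.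
  have := Leps w; rewrite ler_norml => /andP[_ Lw].
  have CE : C * e = e + eps^-1 * e + e.
    by rewrite /C mulrDr mulr1 mulVf ?gt_eqF//; lra.
  by rewrite CE; lra.
have C0 : 0 < C by rewrite /C !(addr_gt0, mulr_gt0).
have le0 x : (forall e, 0 < e -> x <= C * e) -> x <= 0.
  move=> xC; apply/ler_addgt0Pr => e e0; rewrite add0r.
  have := xC (C^-1 * e); rewrite mulrA divff ?gt_eqF// mul1r; apply.
  by rewrite mulr_gt0// invr_gt0.
have l0 : lsubmx z = 0.
  apply: (@row_norm_eq0 _ _ p); apply/eqP; rewrite eq_le row_norm_ge0 andbT.
  by apply: le0 => e /small[].
have r0 : rsubmx z = 0.
  apply: (@row_norm_eq0 _ _ q); apply/eqP; rewrite eq_le row_norm_ge0 andbT.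
  by apply: le0 => e /small[].
by rewrite -[LHS]hsubmxK l0 r0 row_mx0.
Qed.

Definition amalgam : row_norm R (n + m) :=
  RowNorm amalgamD amalgamZ amalgam_eq0.

(** Rewriting cannot make a vector of a summand shorter: what [u] gains in [p] is
paid back in [q (L w) + eps * p w], since [L] loses at most the fraction [eps] of
a norm. The argument for the other summand is symmetric. *)
Lemma amalgam_inl x : amalgam (row_mx x 0) = p x.
Proof.
apply/eqP; rewrite eq_le; apply/andP; split.
  apply: (le_trans (amalgam_le _ 0)).
  rewrite /amalgam_cost row_mxKl row_mxKr !linear0 !addr0 !row_norm0.
  by rewrite mulr0 ?addr0.
apply: amalgam_ge => w; rewrite /amalgam_cost row_mxKl row_mxKr add0r.
have := row_normD p (x - w) w; rewrite subrK.
have := Leps w; rewrite ler_norml; lra.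
Qed.

Lemma amalgam_inr y : amalgam (row_mx 0 y) = q y.
Proof.
apply/eqP; rewrite eq_le; apply/andP; split.
  apply: (le_trans (amalgam_le _ 0)).
  rewrite /amalgam_cost row_mxKl row_mxKr !linear0 !addr0 !row_norm0.
  by rewrite mulr0 addr0 add0r.
apply: amalgam_ge => w; rewrite /amalgam_cost row_mxKl row_mxKr sub0r row_normN.
have := row_normD q (y + L w) (- L w); rewrite addrK row_normN.
have := Leps w; rewrite ler_norml; lra.
Qed.

Lemma amalgam_close w : amalgam (row_mx w (- L w)) <= eps * p w.
Proof.
apply: (le_trans (amalgam_le _ w)).
by rewrite /amalgam_cost row_mxKl row_mxKr subrr addNr !row_norm0 !add0r.
Qed.

End Amalgamation.

(** * Finite families and almost isometries *)

Section Combinations.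
Context (R : realType) (V : lmodType R).
Implicit Types (x : nat -> V) (p : {poly R}).

Lemma linear_subspaceP (F : set V) : linear_subspace F <->
  F 0 /\ forall a u v, F u -> F v -> F (a *: u + v).
Proof.
split=> [[/set_mem F0 FL]|[F0 FL]].
  by split=> // a u v /mem_set Fu /mem_set Fv; exact: set_mem (FL a u v Fu Fv).
by split=> [|a u v /set_mem Fu /set_mem Fv]; apply/mem_set => //; exact: FL.
Qed.

(** Polynomials serve as coefficient vectors of finite support: a bound on the
size says how many vectors of the family are used, and families of different
lengths share the same coefficient space. *)
Definition lincomb x p : V := \sum_(i < size p) p`_i *: x i.

Lemma lincombE n x p : (size p <= n)%N ->
  lincomb x p = \sum_(i < n) p`_i *: x i.
Proof.
move=> pn; rewrite /lincomb (big_ord_widen n (fun i => p`_i *: x i))// big_mkcond.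
apply: eq_bigr => i _; case: ltnP => // pi.
by rewrite nth_default// scale0r.
Qed.

Lemma lincomb_is_linear x : linear (lincomb x).
Proof.
move=> a p q; set n := maxn (size p) (size q).
have pn : (size p <= n)%N by exact: leq_maxl.
have qn : (size q <= n)%N by exact: leq_maxr.
have pqn : (size (a *: p + q)%R <= n)%N.
  rewrite (leq_trans (size_polyD _ _))// geq_max qn andbT.
  exact: leq_trans (size_scale_leq _ _) pn.
rewrite !(@lincombE n)// scaler_sumr -big_split/=; apply: eq_bigr => i _.
by rewrite coefD coefZ scalerDl scalerA.
Qed.

HB.instance Definition _ x := GRing.isLinear.Build R {poly R} V _ (lincomb x)
  (lincomb_is_linear x).

Lemma lincombXn x i : lincomb x 'X^i = x i.
Proof.
rewrite (@lincombE i.+1) ?size_polyXn// (bigD1 ord_max)//= coefXn eqxx scale1r.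
rewrite big1 ?addr0// => j /eqP ji; rewrite coefXn; case: eqP => [ij|]; last first.
  by rewrite scale0r.
by case: ji; exact/val_inj.
Qed.

Lemma eq_lincomb n x y p : (size p <= n)%N ->
  (forall i, (i < n)%N -> x i = y i) -> lincomb x p = lincomb y p.
Proof.
move=> pn xy; rewrite !(@lincombE n)//; apply: eq_bigr => i _.
by rewrite xy.
Qed.

Lemma lincomb_subspace (U : set V) x p : linear_subspace U ->
  (forall i, U (x i)) -> U (lincomb x p).
Proof.
move=> /linear_subspaceP[U0 UL] Ux; rewrite /lincomb.
by elim/big_ind: _ => // [u v Uu Uv|i _]; rewrite -?[u + v]/(u + v);
  [rewrite -[u]scale1r; exact: UL|rewrite -[_ *: _]addr0; exact: UL].
Qed.

Definition free_upto n x :=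
  forall p, (size p <= n)%N -> lincomb x p = 0 -> p = 0.

(** If [d] already lies in the span of the family, nothing is added: freeness has
to be preserved for the family to define a norm on its coefficients. *)
Lemma free_upto_adjoin (W : set V) n x d : (forall i, W (x i)) -> W d ->
  free_upto n x ->
  exists m x', [/\ (n <= m)%N, forall i, W (x' i),
    forall i, (i < n)%N -> x' i = x i, free_upto m x' &
    exists2 p : {poly R}, (size p <= m)%N & lincomb x' p = d].
Proof.
move=> Wx Wd xfree.
have [[p pn pd]|nd] :=
  pselect (exists2 p : {poly R}, (size p <= n)%N & lincomb x p = d).
  by exists n, x; split=> //; exists p.
pose x' i := if i == n then d else x i.
have x'x i : (i < n)%N -> x' i = x i by rewrite /x'; case: ltngtP.
exists n.+1, x'; split=> //.
- by move=> i; rewrite /x'; case: eqP.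
- move=> p pn; rewrite (lincombE _ pn) big_ord_recr/= {2}/x' eqxx => px.
  have tp : lincomb x (take_poly n p) = - (p`_n *: d).
    apply/eqP; rewrite -subr_eq0 opprK -px (lincombE _ (size_take_poly _ _)).
    apply/eqP; congr (_ + _); apply: eq_bigr => i _.
    by rewrite coef_take_poly ltn_ord x'x.
  have [pn0|pn0] := eqVneq p`_n 0.
    have sp : (size p <= n)%N.
      move: pn; rewrite leq_eqVlt => /predU1P[spn|//].
      have /eqP : lead_coef p = 0 by rewrite lead_coefE spn.
      by rewrite lead_coef_eq0 -size_poly_eq0 spn.
    apply: xfree => //.
    by rewrite -(take_poly_id sp) tp pn0 scale0r oppr0.
  case: nd; exists (- (p`_n)^-1 *: take_poly n p).
    exact: leq_trans (size_scale_leq _ _) (size_take_poly _ _).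
  by rewrite linearZ/= tp scalerN scaleNr opprK scalerK.
- exists 'X^n; first by rewrite size_polyXn.
  by rewrite lincombXn /x' eqxx.
Qed.

End Combinations.

(** The Gurarii property of a subspace [U], stated inside an ambient complete
space so that it also makes sense for subspaces that are not closed. *)
Definition gurarii_in (R : realType) (X : completeNormedModType R)
    (U : set X) : Prop :=
  forall (T : completeNormedModType R) (S : set T) (f : T -> X) (eps : R),
    finite_dimensional T -> linear_subspace S ->
    isometric_embedding_on S f -> (forall s, S s -> U (f s)) -> 0 < eps ->
    exists g : {linear T -> X},
      [/\ eps_isometric_embedding eps g, {in S, g =1 f} & forall t, U (g t)].

(** The lower bound is written as an upper bound with the families exchanged, so
that the two sides of the back and forth play symmetric roles. *)
Definition almost_isometric (R : realType) (V W : normedModType R)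
    (eps : R) (n : nat) (x : nat -> V) (y : nat -> W) : Prop :=
  forall p : {poly R}, (size p <= n)%N ->
    `|lincomb y p| <= (1 + eps) * `|lincomb x p| /\
    `|lincomb x p| <= (1 + eps) * `|lincomb y p|.

Lemma almost_isometric_sym (R : realType) (V W : normedModType R)
    (eps : R) (n : nat) (x : nat -> V) (y : nat -> W) :
  almost_isometric eps n x y -> almost_isometric eps n y x.
Proof. by move=> xy p /xy[]. Qed.

Lemma almost_isometric_free (R : realType) (V W : normedModType R)
    (eps : R) (n : nat) (x : nat -> V) (y : nat -> W) :
  almost_isometric eps n x y -> free_upto n x -> free_upto n y.
Proof.
move=> xy xfree p pn yp; apply: xfree => //; have [_] := xy _ pn.
by rewrite yp normr0 mulr0 normr_le0 => /eqP.
Qed.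

Section TupleNorm.
Context (R : realType) (V : normedModType R) (n : nat) (x : nat -> V).
Context (xfree : free_upto n x).

Let N (c : 'rV[R]_n) : R := `|lincomb x (rVpoly c)|.

Let ND u v : N (u + v) <= N u + N v.
Proof. by rewrite /N !linearD/= ler_normD. Qed.

Let NZ a u : N (a *: u) = `|a| * N u.
Proof. by rewrite /N !linearZ/= normrZ. Qed.

Let N0 u : N u = 0 -> u = 0.
Proof.
move=> /normr0_eq0 /xfree; rewrite size_poly => /(_ isT) u0.
by rewrite -(rVpolyK u) u0 linear0.
Qed.

Definition tuple_norm : row_norm R n := RowNorm ND NZ N0.

Lemma tuple_normE (p : {poly R}) : (size p <= n)%N ->
  tuple_norm (poly_rV p) = `|lincomb x p|.
Proof. by move=> pn; rewrite /= /N poly_rV_K. Qed.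

End TupleNorm.

Section Correction.
Context (R : realType) (X : completeNormedModType R) (U : set X).
Context (Y : normedModType R).
Context (Usub : linear_subspace U) (UG : gurarii_in U).

(** Glue the span of [y] (first [n] vectors) and the span of [x] (first [m]
vectors) along the almost isometry. The identity on the copy of the span of [y]
extends to an almost isometry [g] of the whole amalgam into [U], and [y'] is the
image under [g] of the copy of [x]. In the amalgam corresponding vectors of the
two copies are [eps]-close, so [y'] stays close to [y]. *)
Lemma gurarii_in_correct (n m : nat) (x : nat -> Y) (y : nat -> X)
    (eps delta : R) : 0 < eps -> 0 < delta -> (n <= m)%N ->
  free_upto m x -> (forall i, U (y i)) -> almost_isometric eps n x y ->
  exists y' : nat -> X, [/\ forall i, U (y' i), almost_isometric delta m x y' &
    forall p : {poly R}, (size p <= n)%N ->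
      `|lincomb y' p - lincomb y p| <= (1 + delta) * eps * `|lincomb y p|].
Proof.
move=> e0 d0 nm xfree Uy xy.
have yfree : free_upto n y.
  apply: (almost_isometric_free xy) => p pn; apply: xfree; exact: leq_trans nm.
pose L : {linear 'rV[R]_n -> 'rV[R]_m} := poly_rV \o rVpoly.
pose P := tuple_norm yfree; pose Q := tuple_norm xfree.
have LE w : rVpoly (L w) = rVpoly w.
  by rewrite /L/= poly_rV_K// (leq_trans (size_poly _ _)).
have QP w : `|Q (L w) - P w| <= eps * P w.
  rewrite [Q _](_ : _ = `|lincomb x (rVpoly w)|); last by rewrite /= LE.
  rewrite [P _](_ : _ = `|lincomb y (rVpoly w)|)//.
  have [] := xy _ (size_poly _ _ : size (rVpoly w) <= n)%N.
  set a := `|lincomb y _|; set b := `|lincomb x _| => ab ba.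
  rewrite ler_norml; apply/andP; split; last by lra.
  have [le_ab|/ltW le_ba] := leP a b.
    by have := mulr_ge0 (ltW e0) (normr_ge0 _ : 0 <= a); lra.
  by have := ler_wpM2l (ltW e0) le_ba; lra.
pose Z := normed_row (amalgam e0 QP).
pose S : set Z := [set z | rsubmx (z : 'rV_(n + m)) = 0].
pose f (z : Z) : X := lincomb y (rVpoly (lsubmx (z : 'rV_(n + m)))).
have fS : isometric_embedding_on S f.
  split=> [a u v _ _|u /set_mem uS]; first by rewrite /f !linearP.
  rewrite [RHS](_ : _ = amalgam e0 QP u)// -(hsubmxK (u : 'rV_(n + m))).
  by rewrite [rsubmx u]uS amalgam_inl /f row_mxKl.
have SL : linear_subspace S.
  apply/linear_subspaceP; split=> [|a u v]; rewrite /S/= ?linear0// => u0 v0.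
  by rewrite linearP/= u0 v0 scaler0 addr0.
have Uf s : S s -> U (f s) by move=> _; exact: (lincomb_subspace _ Usub Uy).
have [g [giso gf Ug]] := UG (@normed_row_finite_dimensional _ _ _) SL fS Uf d0.
pose y' i := g (row_mx 0 (poly_rV 'X^i) : Z).
pose g0 (u : 'rV[R]_m) : X := g (row_mx 0 u : Z).
have gL : linear g0.
  move=> a u v; rewrite -linearP; congr (g _).
  by rewrite /= scale_row_mx add_row_mx scaler0 addr0.
pose h : {linear 'rV[R]_m -> X} :=
  HB.pack g0 (GRing.isLinear.Build _ _ _ _ g0 gL).
have y'E (p : {poly R}) : lincomb y' p = g (row_mx 0 (poly_rV p) : Z).
  rewrite -[RHS]/(h _) -{2}(coefK p) poly_def !linear_sum/=.
  apply: eq_bigr => i _.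
  by rewrite linearZ/= -[g0 _]/(h _) linearZ.
have nZ (z : Z) : `|z| = amalgam e0 QP z by [].
have bound (z : Z) :
    `|g z| <= (1 + delta) * `|z| /\ `|z| <= (1 + delta) * `|g z|.
  have [->|z0] := eqVneq z 0; first by rewrite linear0 !normr0 mulr0.
  have d1 : 0 < 1 + delta by lra.
  by have [gz zg] := giso _ z0; split=> //; rewrite -ler_pdivrMl.
exists y'; split=> [i|p pm|p pn]; first exact: Ug.
  rewrite y'E -(tuple_normE xfree pm) -(amalgam_inr e0 QP).
  exact: (bound (row_mx 0 (poly_rV p))).
have yE : lincomb y p = g (row_mx (poly_rV p) 0 : Z).
  rewrite gf; first by rewrite /f row_mxKl poly_rV_K.
  by apply/mem_set; rewrite /S/= row_mxKr.
have Lp : poly_rV p = L (poly_rV p) by rewrite /L/= poly_rV_K.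
rewrite y'E {1}yE -linearB.
have [+ _] := bound (row_mx 0 (poly_rV p) - row_mx (poly_rV p) 0 : Z).
move=> /le_trans; apply; rewrite -mulrA ler_wpM2l//; first by lra.
rewrite -[leLHS]normrN opprB.
rewrite [leLHS](_ : _ = amalgam e0 QP (row_mx (poly_rV p) (- L (poly_rV p)))).
  by apply: (le_trans (amalgam_close _ _ _)); rewrite tuple_normE.
rewrite nZ -Lp; congr (amalgam e0 QP _).
by rewrite [LHS]/= opp_row_mx add_row_mx oppr0 addr0 add0r.
Qed.

End Correction.

(** * Countable choices, summable movements, and closures *)

Lemma indexed_dependent_choice (T : Type) (P : nat -> T -> Prop)
    (Q : nat -> T -> T -> Prop) (s0 : T) : P 0%N s0 ->
    (forall k s, P k s -> exists s', P k.+1 s' /\ Q k s s') ->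
  exists f : nat -> T, forall k, P k (f k) /\ Q k (f k) (f k.+1).
Proof.
move=> P0 step.
have /choice[next nextP] : forall ks : nat * T, exists s',
    P ks.1 ks.2 -> P ks.1.+1 s' /\ Q ks.1 ks.2 s'.
  move=> [k s]/=; have [Pks|nP] := pselect (P k s); last by exists s0.
  by have [s' s'P] := step _ _ Pks; exists s'.
pose f := fix f k := if k is j.+1 then next (j, f j) else s0.
have Pf k : P k (f k).
  by elim: k => //= k IH; have [] := nextP (k, f k) IH.
by exists f => k; split=> //; have [] := nextP (k, f k) (Pf k).
Qed.

(** The term of index [j] is the element whose code is the 2-adic valuation of
[j], or [a0] if there is none; each valuation is taken by arbitrarily large
numbers. *)
Lemma countable_enum_often (T : Type) (A : set T) (a0 : T) :
  countable A -> A a0 ->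
  exists f : nat -> T, (forall k, A (f k)) /\
    forall a k, A a -> exists2 j, (k <= j)%N & f j = a.
Proof.
move=> /countable_injP[e einj] Aa0.
have /choice[f fP] : forall i : nat, exists a,
    A a /\ ((exists2 b, A b & e b = logn 2 i) -> e a = logn 2 i).
  move=> i; have [[b Ab ebi]|nb] := pselect (exists2 b, A b & e b = logn 2 i).
    by exists b.
  by exists a0.
exists f; split=> [k|a k Aa]; first by case: (fP k).
exists (2 ^ e a * k.*2.+1)%N.
  by rewrite (leq_trans _ (leq_pmull _ _)) ?expn_gt0// -addnn leqW// leq_addr.
have lE : logn 2 (2 ^ e a * k.*2.+1) = e a.
  rewrite lognM ?expn_gt0// pfactorK// lognE/= dvdn2/= odd_double/=.
  by rewrite addn0.
have [Af fE] := fP (2 ^ e a * k.*2.+1)%N.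
apply: einj; rewrite ?inE//.
by rewrite fE lE//; exists a.
Qed.

Lemma countableU (T : Type) (A B : set T) :
  countable A -> countable B -> countable (A `|` B).
Proof.
move=> Ac Bc; rewrite (_ : _ `|` _ = \bigcup_(b in [set: bool]) if b then A else B).
  by apply: bigcup_countable => [|[]//]; exact: countableP.
by apply/seteqP; split=> [t [At|Bt]|t [[] _ ?]];
  [exists true|exists false|left|right].
Qed.

Lemma half_pow_small (R : realType) (C e : R) : 0 <= C -> 0 < e ->
  exists i, forall j, (i <= j)%N -> 2^-1 ^+ j * C < e.
Proof.
move=> C0 e0; have C1 : 0 < C + 1 by lra.
have : (2^-1 : R) ^+ i @[i --> \oo] --> 0.
  by apply: cvg_expr; rewrite ger0_norm; lra.
move=> /cvgrPdist_lt /(_ _ (divr_gt0 e0 C1)) [i _ ih]; exists i => j /ih/=.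
have j0 : 0 <= 2^-1 ^+ j :> R by rewrite exprn_ge0// invr_ge0.
rewrite sub0r normrN ger0_norm// ltr_pdivlMr// => /le_lt_trans; apply.
by rewrite ler_wpM2l//; lra.
Qed.

(** Relative movements of [2^-(j+2)] at stage [j] at most double the norm, so
they add up to an absolute movement of at most [2^-k] times the norm at stage [k]. *)
Lemma slow_cvg (R : realType) (V : completeNormedModType R) (z : nat -> V)
    (k : nat) :
  (forall j, (k <= j)%N -> `|z j.+1 - z j| <= 2^-1 ^+ j.+2 * `|z j|) ->
  cvg (z @ \oo) /\ `|lim (z @ \oo) - z k| <= 2^-1 ^+ k * `|z k|.
Proof.
have h0 j : 0 < 2^-1 ^+ j :> R by rewrite exprn_gt0// invr_gt0.
have h1 j : 2^-1 ^+ j <= 1 :> R by rewrite exprn_ile1//; lra.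
have tele i :
    (forall j, (i <= j)%N -> `|z j.+1 - z j| <= 2^-1 ^+ j.+2 * `|z j|) ->
    forall m, `|z (i + m)%N - z i| <= 2^-1 ^+ i * `|z i|.
  move=> zi m.
  have : `|z (i + m)%N - z i| <= (1 - 2^-1 ^+ m) * (2^-1 ^+ i * `|z i|).
    (* The factor [1 - 2^-m] leaves room for the movement of the next stage. *)
    elim: m => [|m IH]; first by rewrite addn0 subrr normr0 expr0 subrr mul0r.
    have b0 : 0 <= `|z i| by [].
    have zm : `|z (i + m)%N| <= 2 * `|z i|.
      have := ler_normD (z (i + m)%N - z i) (z i); rewrite subrK => /le_trans; apply.
      have B0 : 0 <= 2^-1 ^+ i * `|z i| by rewrite mulr_ge0// ltW.
      have B1 : 2^-1 ^+ i * `|z i| <= 1 * `|z i| by rewrite ler_wpM2r.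
      by have := mulr_ge0 (ltW (h0 m)) B0; lra.
    have := ler_normD (z (i + m.+1)%N - z (i + m)%N) (z (i + m)%N - z i).
    rewrite addrA subrK => /le_trans; apply.
    have := zi (i + m)%N (leq_addr _ _); rewrite -addnS => st.
    have st2 : `|z (i + m.+1)%N - z (i + m)%N| <=
        2^-1 ^+ (i + m.+2) * (2 * `|z i|).
      rewrite !addnS in st *; apply: (le_trans st).
      by rewrite ler_wpM2l// ltW.
    apply: (le_trans (lerD st2 IH)).
    by rewrite exprD !exprS; lra.
  move=> /le_trans; apply; rewrite -[leRHS]mul1r.
  by rewrite ler_wpM2r ?gerBl ?(ltW (h0 _))// mulr_ge0 ?(ltW (h0 _)).
move=> zk.
have zcvg : cvg (z @ \oo).
  apply/cauchy_cvgP/cauchy_exP => e e0.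
  have [i0 i0P] := half_pow_small (mulr_ge0 (ler0n _ 2) (normr_ge0 (z k))) e0.
  pose i := maxn k i0; have ki : (k <= i)%N by exact: leq_maxl.
  have ie : 2^-1 ^+ i * (2 * `|z k|) < e by apply: i0P; exact: leq_maxr.
  exists (z i); exists i => // j /= ij; rewrite -ball_normE/= -normrN opprB.
  apply: le_lt_trans ie.
  rewrite -(subnKC ij); apply: le_trans (tele i _ _) _.
    by move=> j' ij'; apply: zk; exact: leq_trans ki ij'.
  rewrite ler_wpM2l ?(ltW (h0 _))//.
  have := tele k zk (i - k)%N; rewrite subnKC// => ti.
  have := ler_normD (z i - z k) (z k); rewrite subrK => /le_trans; apply.
  have : 2^-1 ^+ k * `|z k| <= 1 * `|z k| by rewrite ler_wpM2r.
  lra.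
split=> //.
have nc : `|z j - z k| @[j --> \oo] --> `|lim (z @ \oo) - z k|.
  by apply: cvg_norm; apply: cvgB => //; exact: cvg_cst.
rewrite -(cvg_lim _ nc)//; apply: limr_le; first by apply/cvg_ex; eexists; exact: nc.
exists k => // j /= kj; rewrite -(subnKC kj); exact: tele.
Qed.

Section IsometryCompletion.
Context (R : realType) (M : lmodType R) (P : set M).
Context (PL : linear_subspace P).

(** The closure of the graph of the correspondence sending [a p] to [b p]. It is
symmetric in the two sides, so totality gives both the domain and the range of
the extended isometry. *)
Definition limit_pair (V W : normedModType R) (a : M -> V) (b : M -> W)
    (v : V) (w : W) : Prop :=
  forall e, 0 < e -> exists p, [/\ P p, `|a p - v| < e & `|b p - w| < e].

Lemma limit_pair_sym (V W : normedModType R) (a : M -> V) (b : M -> W) v w :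
  limit_pair a b v w -> limit_pair b a w v.
Proof. by move=> ab e /ab[p [Pp ? ?]]; exists p. Qed.

Definition linear_within (V : lmodType R) (a : M -> V) : Prop :=
  forall c p q, P p -> P q -> a (c *: p + q) = c *: a p + a q.

(** Approximate [v] by values of [a]; as the correspondence is isometric, the
matching values of [b] form a Cauchy sequence. *)
Lemma limit_pair_total (V : normedModType R) (W : completeNormedModType R)
    (a : M -> V) (b : M -> W) : linear_within a -> linear_within b ->
    (forall p, P p -> `|a p| = `|b p|) ->
  forall v, closure (a @` P) v -> exists w, limit_pair a b v w.
Proof.
move=> aL bL ab v av.
have PB p q : P p -> P q -> P (- 1 *: q + p).
  by move/linear_subspaceP: PL => [_ PL'] Pp Pq; exact: PL'.
have dist p q : P p -> P q -> `|b p - b q| = `|a p - a q|.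
  move=> Pp Pq; rewrite addrC -scaleN1r -bL// -ab; last exact: PB.
  by rewrite aL// scaleN1r addrC.
have /choice[s sP] : forall k : nat, exists p, P p /\ `|a p - v| < 2^-1 ^+ k.
  move=> k; have k0 : 0 < 2^-1 ^+ k :> R by rewrite exprn_gt0// invr_gt0.
  have [_ [[p Pp <-] pv]] := av _ (nbhsx_ballx v _ k0).
  by exists p; split=> //; move: pv; rewrite -ball_normE/= -normrN opprB.
have small (e : R) : 0 < e ->
    exists i, forall j, (i <= j)%N -> `|a (s j) - v| < e.
  move=> e0.
  have [i ih] := half_pow_small ler01 e0; exists i => j /ih.
  by rewrite mulr1; apply: lt_trans; case: (sP j).
have : cvg (b (s k) @[k --> \oo]).
  apply/cauchy_cvgP/cauchy_exP => e e0; have e20 : 0 < e / 2 by lra.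
  have [i ih] := small _ e20; exists (b (s i)), i => // j /= /ih jv.
  rewrite -ball_normE/= dist; [|by case: (sP i)|by case: (sP j)].
  have := ler_normD (a (s i) - v) (- (a (s j) - v)); rewrite normrN.
  have := ih i (leqnn _); rewrite opprB addrA subrK; lra.
move=> /cvg_ex[w bw]; exists w => e e0.
have [i ih] := small _ e0; move/cvgrPdist_lt : bw => /(_ _ e0)[i' _ ih'].
exists (s (maxn i i')); split; [by case: (sP (maxn i i'))| |].
  by apply: ih; exact: leq_maxl.
by rewrite -normrN opprB; apply: ih'; exact: leq_maxr.
Qed.

(** The closed graph is linear and preserves norms, so it is single-valued: two
values of the same vector differ by a value of 0. *)
Lemma extend_isometry (V W : completeNormedModType R)
    (a : M -> V) (b : M -> W) : linear_within a -> linear_within b ->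
    (forall p, P p -> `|a p| = `|b p|) -> closure (a @` P) = [set: V] ->
  exists u : V -> W,
    isometric_embedding_on [set: V] u /\ range u = closure (b @` P).
Proof.
move=> aL bL ab adense.
have lin c v v' w w' : limit_pair a b v w -> limit_pair a b v' w' ->
    limit_pair a b (c *: v + v') (c *: w + w').
  move=> vw vw' e e0; pose d := e / (`|c| + 1).
  have c0 : 0 <= `|c| by [].
  have d0 : 0 < d by rewrite divr_gt0//; lra.
  have [p [Pp pv pw]] := vw _ d0; have [q [Pq qv qw]] := vw' _ d0.
  have cde : `|c| * d + d = e by rewrite /d; field; rewrite gt_eqF//; lra.
  exists (c *: p + q); split; first by move/linear_subspaceP: PL => [_]; exact.
    rewrite aL// opprD addrACA -scalerBr (le_lt_trans (ler_normD _ _))// normrZ.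
    by have := ler_wpM2l c0 (ltW pv); lra.
  rewrite bL// opprD addrACA -scalerBr (le_lt_trans (ler_normD _ _))// normrZ.
  by have := ler_wpM2l c0 (ltW pw); lra.
have nrm v w : limit_pair a b v w -> `|w| = `|v|.
  move=> vw; apply/eqP; rewrite -subr_eq0 -normr_le0.
  apply/ler_addgt0Pr => e e0; rewrite add0r; have e20 : 0 < e / 2 by lra.
  have [p [Pp pv pw]] := vw _ e20; have := ab p Pp.
  have := ler_dist_dist (a p) v; have := ler_dist_dist (b p) w.
  rewrite !ler_norml => /andP[? ?] /andP[? ?] abp; apply/andP; split; lra.
have uniq v w w' : limit_pair a b v w -> limit_pair a b v w' -> w = w'.
  move=> vw vw'; apply/eqP; rewrite -subr_eq0 -normr_eq0 -normrN opprB.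
  have := nrm _ _ (lin (- 1) _ _ _ _ vw vw').
  by rewrite !scaleN1r addNr addrC normr0 => ->.
have /choice[u uP] : forall v, exists w, limit_pair a b v w.
  by move=> v; apply: limit_pair_total => //; rewrite adense.
exists u; split.
  split=> [c v v' _ _|v _]; last exact: nrm.
  by apply: uniq (uP _) _; exact: lin.
apply/seteqP; split=> [_ [v _ <-]|w bw].
  move=> B /nbhs_ballP[e/= e0 eB].
  have [p [Pp _ pu]] := uP v _ e0; exists (b p); split; first by exists p.
  by apply: eB; rewrite -ball_normE/= -normrN opprB.
have [v /limit_pair_sym vw] : exists v, limit_pair b a w v.
  by apply: limit_pair_total => // p /ab.
by exists v => //; exact: uniq (uP v) vw.
Qed.

End IsometryCompletion.

(** * Back and forth *)

Section BackAndForth.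
Context (R : realType) (Y X : completeNormedModType R) (V : set Y) (U : set X).
Context (Vsub : linear_subspace V) (Usub : linear_subspace U).
Context (VG : gurarii_in V) (UG : gurarii_in U).

Definition matched (eps : R) (n : nat) (x : nat -> Y) (y : nat -> X) : Prop :=
  [/\ forall i, V (x i), forall i, U (y i), free_upto n x &
      almost_isometric eps n x y].

Lemma eq_almost_isometric (W W' : normedModType R) (eps : R) n
    (x x' : nat -> W) (y : nat -> W') :
  (forall i, (i < n)%N -> x' i = x i) ->
  almost_isometric eps n x y -> almost_isometric eps n x' y.
Proof. by move=> xx xy p pn; rewrite (eq_lincomb pn xx); exact: xy. Qed.

(** Forth: adjoin [d] to [x] and correct [y] accordingly. Back: adjoin [e] to [y]
and correct [x] with the final precision [eps']. The second correction displaces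
the vector [d], which is therefore only approximately in the new span, whereas
[e] is in it exactly. *)
Lemma matched_step (eps eps' : R) n x y d e :
  0 < eps <= 1 -> 0 < eps' <= 1 -> V d -> U e -> matched eps n x y ->
  exists n' x' y', [/\ (n <= n')%N, matched eps' n' x' y',
    forall p : {poly R}, (size p <= n)%N ->
      `|lincomb x' p - lincomb x p| <= 2 * eps * `|lincomb x p| /\
      `|lincomb y' p - lincomb y p| <= 2 * eps * `|lincomb y p|,
    exists2 p : {poly R}, (size p <= n')%N &
      `|lincomb x' p - d| <= 2 * eps * `|d| &
    exists2 p : {poly R}, (size p <= n')%N & lincomb y' p = e].
Proof.
move=> /andP[e0 e1] /andP[e'0 e'1] Vd Ue [Vx Uy xfree xy].
have [m [x1 [nm Vx1 x1x x1free [pd pdm pdE]]]] := free_upto_adjoin Vx Vd xfree.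
have [y1 [Uy1 x1y1 y1y]] := gurarii_in_correct Usub UG e0 e0 nm x1free Uy
  (eq_almost_isometric x1x xy).
have y1free := almost_isometric_free x1y1 x1free.
have [n' [y2 [mn' Uy2 y2y1 y2free [pe pen' peE]]]] :=
  free_upto_adjoin Uy1 Ue y1free.
have y2x1 := eq_almost_isometric y2y1 (almost_isometric_sym x1y1).
have [x2 [Vx2 y2x2 x2x1]] :=
  gurarii_in_correct Vsub VG e0 e'0 mn' y2free Vx1 y2x1.
have scale2 delta a : 0 < delta <= 1 -> 0 <= a ->
    (1 + delta) * eps * a <= 2 * eps * a.
  move=> /andP[? ?] a0; rewrite ler_wpM2r// ler_wpM2r ?(ltW e0)//; lra.
exists n', x2, y2; split.
- exact: leq_trans mn'.
- split=> //; first exact: almost_isometric_free y2x2 y2free.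
  exact: almost_isometric_sym.
- move=> p pn; have pm := leq_trans pn nm; split.
    rewrite -(eq_lincomb pn x1x).
    by apply: le_trans (x2x1 _ pm) _; rewrite scale2// e'0.
  rewrite (eq_lincomb pm y2y1).
  by apply: le_trans (y1y _ pn) _; rewrite scale2// e0.
- exists pd; first exact: leq_trans mn'.
  by rewrite -pdE; apply: le_trans (x2x1 _ pdm) _; rewrite scale2// e'0.
- by exists pe.
Qed.

(** The errors [2^-(k+3)] are chosen so that the movement [2 * 2^-(k+3)] of a
stage fits [slow_cvg]. Each vector of [D] and [C] is treated at infinitely many
stages, because what is reached at a late stage moves little afterwards. *)
Lemma back_and_forth (D : set Y) (C : set X) :
  countable D -> D `<=` V -> countable C -> C `<=` U ->
  exists (n : nat -> nat) (x : nat -> nat -> Y) (y : nat -> nat -> X),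
  [/\ forall k, matched (2^-1 ^+ k.+3) (n k) (x k) (y k),
      forall k, (n k <= n k.+1)%N,
      forall k (p : {poly R}), (size p <= n k)%N ->
        `|lincomb (x k.+1) p - lincomb (x k) p| <=
          2^-1 ^+ k.+2 * `|lincomb (x k) p| /\
        `|lincomb (y k.+1) p - lincomb (y k) p| <=
          2^-1 ^+ k.+2 * `|lincomb (y k) p|,
      forall d j, D d ->
        exists k (p : {poly R}), [/\ (j <= k)%N, (size p <= n k)%N &
        `|lincomb (x k) p - d| <= 2^-1 ^+ j * `|d|] &
      forall c j, C c ->
        exists k (p : {poly R}), [/\ (j <= k)%N, (size p <= n k)%N &
        lincomb (y k) p = c]].
Proof.
move=> Dc DV Cc CU.
have V0 : V 0 by case/linear_subspaceP: Vsub.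
have U0 : U 0 by case/linear_subspaceP: Usub.
have [d [dD dd]] : exists d : nat -> Y, (forall k, V (d k)) /\
    forall a k, D a -> exists2 j, (k <= j)%N & d j = a.
  have [] := @countable_enum_often _ (0 |` D) 0.
  - exact: countableU (countable1 _) _.
  - by left.
  - move=> d [d1 d2]; exists d; split=> [k|a k Da]; last by apply: d2; right.
    by case: (d1 k) => [->|/DV].
have [c [cC cc]] : exists c : nat -> X, (forall k, U (c k)) /\
    forall a k, C a -> exists2 j, (k <= j)%N & c j = a.
  have [] := @countable_enum_often _ (0 |` C) 0.
  - exact: countableU (countable1 _) _.
  - by left.
  - move=> c [c1 c2]; exists c; split=> [k|a k Ca]; last by apply: c2; right.
    by case: (c1 k) => [->|/CU].
have h0 j : 0 < 2^-1 ^+ j :> R by rewrite exprn_gt0// invr_gt0.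
have h1 j : 2^-1 ^+ j <= 1 :> R by rewrite exprn_ile1//; lra.
have hle i j : (i <= j)%N -> 2^-1 ^+ j <= 2^-1 ^+ i :> R.
  by move=> ij; rewrite ler_wiXn2l ?invr_ge0 ?invf_le1 ?ler1n.
pose St := (nat * (nat -> Y) * (nat -> X))%type.
pose P k (s : St) := matched (2^-1 ^+ k.+3) s.1.1 s.1.2 s.2.
pose Q k (s s' : St) := [/\ (s.1.1 <= s'.1.1)%N,
    forall p : {poly R}, (size p <= s.1.1)%N ->
      `|lincomb s'.1.2 p - lincomb s.1.2 p| <=
        2^-1 ^+ k.+2 * `|lincomb s.1.2 p| /\
      `|lincomb s'.2 p - lincomb s.2 p| <= 2^-1 ^+ k.+2 * `|lincomb s.2 p|,
    exists2 p : {poly R}, (size p <= s'.1.1)%N &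
      `|lincomb s'.1.2 p - d k| <= 2^-1 ^+ k.+2 * `|d k| &
    exists2 p : {poly R}, (size p <= s'.1.1)%N & lincomb s'.2 p = c k].
have P0 : P 0%N (0%N, fun=> 0, fun=> 0).
  split=> // p; rewrite ?leqn0 ?size_poly_eq0 => /eqP ->//.
  by rewrite !linear0 !normr0 mulr0.
have step k s : P k s -> exists s', P k.+1 s' /\ Q k s s'.
  case: s => -[n x] y Ps.
  have eE : 2 * 2^-1 ^+ k.+3 = 2^-1 ^+ k.+2 :> R.
    by rewrite exprS mulrA divff// mul1r.
  have := matched_step _ _ (dD k) (cC k) Ps.
  move=> /(_ (2^-1 ^+ k.+4)); rewrite !h0 !h1 eE.
  move=> /(_ isT isT) [n' [x' [y' [? ? ? ? ?]]]].
  by exists (n', x', y').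
have [f fP] := indexed_dependent_choice P0 step.
exists (fun k => (f k).1.1), (fun k => (f k).1.2), (fun k => (f k).2); split.
- by move=> k; case: (fP k).
- by move=> k; case: (fP k) => _ [].
- by move=> k; case: (fP k) => _ [].
- move=> a j Da; have [k jk <-] := dd _ j Da.
  have [_ [_ _ [p pn pd] _]] := fP k; exists k.+1, p; split=> //.
    exact: leqW.
  by apply: le_trans pd _; rewrite ler_wpM2r// hle//; exact: leqW (leqW jk).
- move=> a j Ca; have [k jk <-] := cc _ j Ca.
  have [_ [_ _ _ [p pn pc]]] := fP k; exists k.+1, p; split=> //.
  exact: leqW.
Qed.

End BackAndForth.

(** * Limits of the back-and-forth construction *)

Lemma closure_sub_closed (T : topologicalType) (A B : set T) :
  closed B -> A `<=` B -> closure A `<=` B.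
Proof. by move=> Bc AB; rewrite (closure_id B).1//; exact: closure_subset. Qed.

Section Limit.
Context (R : realType).

Lemma closure_normP (V : normedModType R) (A : set V) v :
  (forall e, 0 < e -> exists2 w, A w & `|w - v| < e) -> closure A v.
Proof.
move=> Av B /nbhs_ballP[e/= e0 eB]; have [w Aw wv] := Av e e0.
by exists w; split=> //; apply: eB; rewrite -ball_normE/= -normrN opprB.
Qed.

Lemma almost_le_lim (u v : nat -> R) a b : u @ \oo --> a -> v @ \oo --> b ->
  (\forall k \near \oo, u k <= (1 + 2^-1 ^+ k.+3) * v k) -> a <= b.
Proof.
move=> ua vb uv.
have h : (2^-1 : R) ^+ k @[k --> \oo] --> 0.
  by apply: cvg_expr; rewrite ger0_norm; lra.
have h3 : (2^-1 : R) ^+ k.+3 @[k --> \oo] --> 0.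
  rewrite -(cvg_shiftn 3) in h; apply: cvg_trans h; apply: near_eq_cvg.
  by near=> k; rewrite /= addn3.
have : (1 + 2^-1 ^+ k.+3) * v k @[k --> \oo] --> (1 + 0) * b.
  by apply: cvgM => //; apply: cvgD => //; exact: cvg_cst.
rewrite addr0 mul1r => vb'.
rewrite -(cvg_lim _ ua)// -(cvg_lim _ vb')//; apply: ler_lim => //.
- by apply/cvg_ex; exists a.
- by apply/cvg_ex; exists b.
Unshelve. all: by end_near. Qed.

Context (V : completeNormedModType R) (n : nat -> nat) (x : nat -> nat -> V).
Context (nle : forall k, (n k <= n k.+1)%N).
Context (xslow : forall k (p : {poly R}), (size p <= n k)%N ->
  `|lincomb (x k.+1) p - lincomb (x k) p| <= 2^-1 ^+ k.+2 * `|lincomb (x k) p|).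

Lemma size_monotone i j : (i <= j)%N -> (n i <= n j)%N.
Proof.
move=> /subnKC <-; elim: (j - i)%N => [|k IH]; rewrite ?addn0//.
by rewrite addnS (leq_trans IH).
Qed.

Definition lim_lincomb (p : {poly R}) : V := lim (lincomb (x k) p @[k --> \oo]).

Lemma lim_lincombP k (p : {poly R}) : (size p <= n k)%N ->
  lincomb (x j) p @[j --> \oo] --> lim_lincomb p /\
  `|lim_lincomb p - lincomb (x k) p| <= 2^-1 ^+ k * `|lincomb (x k) p|.
Proof.
move=> pk.
have [] := @slow_cvg R V (fun j => lincomb (x j) p) k; last by [].
by move=> j kj; apply: xslow; apply: leq_trans pk _; exact: size_monotone.
Qed.

(** Beyond the length [n k] the family [x k] is arbitrary, so only coefficients
supported below some [n k] have a meaningful limit. *)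
Definition eventually_spanned : set {poly R} :=
  [set p : {poly R} | exists k, (size p <= n k)%N].

Lemma eventually_spanned_subspace : linear_subspace eventually_spanned.
Proof.
apply/linear_subspaceP; split=> [|a p q [i pi] [j qj]].
  by exists 0%N; rewrite size_poly0.
exists (maxn i j); rewrite (leq_trans (size_polyD _ _))// geq_max.
rewrite (leq_trans (size_scale_leq _ _)) ?(leq_trans pi) ?(leq_trans qj)//.
- by apply: size_monotone; exact: leq_maxr.
- by apply: size_monotone; exact: leq_maxl.
Qed.

Lemma lim_lincomb_linear : linear_within eventually_spanned lim_lincomb.
Proof.
move=> c p q [i /lim_lincombP[pl _]] [j /lim_lincombP[ql _]].
apply: cvg_lim => //.
under eq_fun do rewrite linearP/=.
by apply: cvgD => //; exact: cvgZ (cvg_cst _) _.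
Qed.

(** A combination formed at stage [k] moves by at most [2^-k] times its own norm
in the limit, and that norm is bounded because the combinations stay near [v]. *)
Lemma lim_lincomb_approx v (C : R) : 0 <= C ->
    (forall j, exists k (p : {poly R}), [/\ (j <= k)%N, (size p <= n k)%N &
      `|lincomb (x k) p - v| <= 2^-1 ^+ j * C]) ->
  closure (lim_lincomb @` eventually_spanned) v.
Proof.
move=> C0 xv; apply: closure_normP => e e0.
have B0 : 0 <= 2 * C + `|v| by have : 0 <= `|v| by []; lra.
have [j /(_ _ (leqnn _)) je] := half_pow_small B0 e0.
have [k [p [jk pk pv]]] := xv j; have [_ px] := lim_lincombP pk.
exists (lim_lincomb p); first by exists p => //; exists k.
have h0 i : 0 <= 2^-1 ^+ i :> R by rewrite exprn_ge0// invr_ge0.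
have hj1 : 2^-1 ^+ j <= 1 :> R by rewrite exprn_ile1//; lra.
have hkj : 2^-1 ^+ k <= 2^-1 ^+ j :> R.
  by rewrite ler_wiXn2l ?invr_ge0 ?invf_le1 ?ler1n.
have xk : `|lincomb (x k) p| <= C + `|v|.
  have := ler_normD (lincomb (x k) p - v) v; rewrite subrK => /le_trans; apply.
  by rewrite lerD2r (le_trans pv)// ler_piMl.
have px' : `|lim_lincomb p - lincomb (x k) p| <= 2^-1 ^+ j * (C + `|v|).
  by apply: le_trans px _; apply: ler_pM.
have := ler_normD (lim_lincomb p - lincomb (x k) p) (lincomb (x k) p - v).
rewrite addrA subrK => /le_lt_trans; apply; apply: le_lt_trans je.
by apply: le_trans (lerD px' pv) _; lra.
Qed.

Lemma lim_lincomb_closure (U : set V) p : linear_subspace U ->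
  (forall k i, U (x k i)) -> eventually_spanned p -> closure U (lim_lincomb p).
Proof.
move=> Usub Ux [k /lim_lincombP[xl _]].
apply: closure_normP => e e0; move/cvgrPdist_lt : xl => /(_ _ e0)[j _ ej].
exists (lincomb (x j) p); first exact: lincomb_subspace.
by rewrite -normrN opprB; apply: ej => /=.
Qed.

End Limit.

(** In the limit, the correspondence built by [back_and_forth] is isometric, it is
densely defined because a dense subset of [Y] was treated, and its values come
arbitrarily close to each vector of [C]. The range lies only in the closure of
[U], since its vectors are limits of vectors of [U]. *)
Lemma gurarii_isometry_absorbing (R : realType) (Y X : completeNormedModType R)
    (U : set X) (C : set X) :
  separable_set [set: Y] -> gurarii_in [set: Y] ->
  linear_subspace U -> gurarii_in U -> countable C -> C `<=` U ->
  exists u : Y -> X, [/\ isometric_embedding_on [set: Y] u, closed (range u),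
    C `<=` range u & range u `<=` closure U].
Proof.
move=> [D [Dc _ Ddense]] YG Usub UG Cc CU.
have Tsub : linear_subspace [set: Y] by apply/linear_subspaceP.
have [n [x [y [xy nle slow Dx Cy]]]] :=
  back_and_forth Tsub Usub YG UG Dc (@subsetT _ D) Cc CU.
have xslow k p pk := (slow k p pk).1; have yslow k p pk := (slow k p pk).2.
pose P := eventually_spanned (R := R) n.
have iso p : P p -> `|lim_lincomb x p| = `|lim_lincomb y p|.
  move=> [k pk]; have [xl _] := lim_lincombP nle xslow pk.
  have [yl _] := lim_lincombP nle yslow pk.
  have xy' : \forall j \near \oo,
      `|lincomb (y j) p| <= (1 + 2^-1 ^+ j.+3) * `|lincomb (x j) p| /\
      `|lincomb (x j) p| <= (1 + 2^-1 ^+ j.+3) * `|lincomb (y j) p|.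
    exists k => // j /= kj; have [_ _ _] := xy j; apply.
    by apply: leq_trans pk _; exact: size_monotone.
  apply/eqP; rewrite eq_le; apply/andP; split.
    apply: almost_le_lim (cvg_norm xl) (cvg_norm yl) _.
    by apply: filterS xy' => j [].
  apply: almost_le_lim (cvg_norm yl) (cvg_norm xl) _.
  by apply: filterS xy' => j [].
have xdense : closure (lim_lincomb x @` P) = [set: Y].
  apply/seteqP; split=> // v _; apply: closure_sub_closed (Ddense v I).
    exact: closed_closure.
  move=> d Dd.
  by apply: (lim_lincomb_approx nle xslow (C := `|d|)) => // j; exact: Dx.
have [u [uiso urange]] := extend_isometry (eventually_spanned_subspace R nle)
  (lim_lincomb_linear nle xslow) (lim_lincomb_linear nle yslow) iso xdense.
exists u; rewrite urange; split=> //; first exact: closed_closure.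
  move=> c Cc'; apply: (lim_lincomb_approx nle yslow (C := 0)) => // j.
  have [k [p [jk pk <-]]] := Cy c j Cc'; exists k, p; split=> //.
  by rewrite subrr normr0 mulr0.
apply: closure_sub_closed; first exact: closed_closure.
move=> _ [p Pp <-]; apply: (lim_lincomb_closure nle yslow) => // k i.
by have [_] := xy k.
Qed.

(** * Directed unions of copies of the separable space *)

(** Induction on the number [k] of generators allowed. If some vector of [S] has
a nonzero coefficient at the new generator, then it and the vectors that avoid
the new generator span everything, and a member of the family above two given
ones works. This avoids choosing a basis of [S]. *)
Lemma directed_absorbs (R : realType) (T V : lmodType R) (Fam : set (set V))
    (S : set T) (f : T -> V) :
  directed Fam -> (forall F, Fam F -> linear_subspace F) ->
  finite_dimensional T -> linear_subspace S -> linear_within S f ->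
  (forall s, S s -> exists2 F, Fam F & F (f s)) ->
  exists2 F, Fam F & forall s, S s -> F (f s).
Proof.
move=> Fdir Fsub [n [e eP]] /linear_subspaceP[S0 SL] fL fS.
pose comb (c : 'I_n -> R) := \sum_(i < n) c i *: e i.
suff span k : exists2 F, Fam F & forall c,
    (forall i : 'I_n, (k <= i)%N -> c i = 0) ->
    S (comb c) -> F (f (comb c)).
  have [F FF Fn] := span n; exists F => // s Ss; have [c sc] := eP s.
  by rewrite sc; apply: Fn; rewrite /comb -?sc// => i; rewrite leqNgt ltn_ord.
elim: k => [|k [F FF Fk]].
  have [F FF F0] := fS _ S0; exists F => // c c0 _.
  by rewrite /comb big1// => i _; rewrite c0// scale0r.
have [[i0 [c0 [i0k c0k Sc0 c00]]]|nex] :=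
  pselect (exists (i0 : 'I_n) (c0 : 'I_n -> R),
    [/\ i0 = k :> nat, forall i : 'I_n, (k.+1 <= i)%N -> c0 i = 0,
        S (comb c0) & c0 i0 != 0]).
  have [F0 FF0 F0c] := fS _ Sc0; have [H FH FFH] := Fdir _ _ FF FF0.
  exists H => // c ck Sc; pose t := c i0 / c0 i0; pose c' i := c i - t * c0 i.
  have cE : comb c = t *: comb c0 + comb c'.
    rewrite /comb scaler_sumr -big_split/=; apply: eq_bigr => i _.
    by rewrite scalerA -scalerDl addrC subrK.
  have Sc' : S (comb c').
    by have := SL (- t) _ _ Sc0 Sc; rewrite cE scaleNr addrA addNr add0r.
  rewrite cE fL//; have /linear_subspaceP[_] := Fsub _ FH; apply.
    by apply: FFH; right.
  apply: FFH; left; apply: Fk => // i; rewrite leq_eqVlt => /predU1P[ki|ki].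
    have -> : i = i0 by apply/val_inj; rewrite /= i0k.
    by rewrite /c' /t divfK// subrr.
  by rewrite /c' ck// c0k// mulr0 subrr.
exists F => // c ck Sc; apply: Fk => // i.
rewrite leq_eqVlt => /predU1P[ki|]; last exact: ck.
by apply: contrapT => /eqP ci0; apply: nex; exists i, c.
Qed.

Lemma isometric_embedding_subspace (R : realType) (V W : normedModType R)
    (u : V -> W) : isometric_embedding_on [set: V] u -> linear_subspace (range u).
Proof.
move=> [uL _]; apply/linear_subspaceP; split=> [|a _ _ [v _ <-] [w _ <-]].
  exists (0 + - 1 *: 0) => //; rewrite addrC uL ?in_setT//.
  by rewrite scaleN1r addNr.
by exists (a *: v + w) => //; rewrite uL ?in_setT.
Qed.

(** The given embedding takes its values in a single copy of [G]; carry it back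
to [G], extend it there, and return. *)
Lemma directed_gurarii_in (R : realType) (G X : completeNormedModType R)
    (Fam : set (set X)) :
  gurarii G -> directed Fam -> (forall F, Fam F -> linearly_isometric_to G F) ->
  gurarii_in (\bigcup_(F in Fam) F).
Proof.
move=> GG Fdir FG T S f eps Tfd SL [fL fN] fU e0.
have Fsub F : Fam F -> linear_subspace F.
  by move=> /FG[u [uiso <-]]; exact: isometric_embedding_subspace.
have fL' : linear_within S f by move=> c p q Sp Sq; apply: fL; exact/mem_set.
have [F FF Ff] : exists2 F, Fam F & forall s, S s -> F (f s).
  by apply: directed_absorbs => // s /fU[F]; exists F.
have [u [[uL uN] uF]] := FG _ FF.
have uL' : linear u by move=> a v w; rewrite uL ?in_setT.
have uN' v : `|u v| = `|v| by rewrite uN ?in_setT.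
pose U : {linear G -> X} := HB.pack u (GRing.isLinear.Build _ _ _ _ u uL').
have uinj : injective u.
  move=> v w /eqP; rewrite -subr_eq0 -[u v - u w](linearB U) -normr_eq0 uN'.
  by rewrite normr_eq0 subr_eq0 => /eqP.
have /choice[h hP] : forall t, exists g, S t -> u g = f t.
  move=> t; have [St|nSt] := pselect (S t); last by exists 0.
  by move: (Ff _ St); rewrite -uF => -[g _ ug]; exists g.
have hiso : isometric_embedding_on S h.
  split=> [a v w|v] /set_mem Sv; last by rewrite -uN' hP// fN// mem_set.
  move=> /set_mem Sw; apply: uinj; rewrite uL' !hP//; first exact: fL'.
  by move/linear_subspaceP: SL => [_]; exact.
have [g [giso gh]] := GG _ _ _ _ Tfd SL hiso e0.
exists (U \o g); split=> [x x0|s sS|t].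
- by rewrite /= uN'; exact: giso.
- by rewrite /= gh// hP//; exact: set_mem.
- by exists F => //; rewrite -uF; exists (g t).
Qed.

Lemma isometric_copy_separable (R : realType) (G X : normedModType R)
    (F : set X) :
  separable_set [set: G] -> linearly_isometric_to G F -> separable_set F.
Proof.
move=> [D [Dc _ DG]] [u [uiso uF]]; exists (u @` D); split.
- exact: card_le_trans (card_image_le _ _) Dc.
- by rewrite -uF => _ [v _ <-]; exists v.
have [uL uN] := uiso.
rewrite -uF => _ [v _ <-]; apply: closure_normP => e e0.
have [w [Dw vw]] := DG v I _ (nbhsx_ballx v _ e0); exists (u w); first by exists w.
have -> : u w - u v = u (- 1 *: v + w).
  by rewrite uL ?in_setT// scaleN1r addrC.
by rewrite uN ?in_setT// scaleN1r addrC -normrN opprB; move: vw; rewrite -ball_normE.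
Qed.

(** * The equivalence *)

Theorem theorem3p4 (R : realType) (G : completeNormedModType R)
  (G_separable : separable_set [set: G]) (G_gurarii : gurarii G)
  (X : completeNormedModType R) :
  [<-> gurarii X;
       exists Fam : set (set X),
         skeleton Fam /\ (forall F, Fam F -> linearly_isometric_to G F);
       exists Fam : set (set X),
         [/\ directed Fam,
             forall F, Fam F -> closed_subspace F,
             forall F, Fam F -> linearly_isometric_to G F
           & covers Fam]].
Proof.
have gurarii_inT (Y : completeNormedModType R) :
    gurarii Y -> gurarii_in [set: Y].
  move=> YG T S f eps Td SL fiso _ e0.
  by have [g [? ?]] := YG T S f eps Td SL fiso e0; exists g.
tfae; last first.
- move=> [Fam [Fdir _ FG Fcov]] T S f eps Td SL fiso e0.
  have := directed_gurarii_in G_gurarii Fdir FG; rewrite [X in gurarii_in X]Fcov.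
  by move=> /(_ T S f eps Td SL fiso (fun _ _ => I) e0)[g [? ? _]]; exists g.
- by move=> [Fam [[Fcl _ Fcov Fdir _] FG]]; exists Fam.
move=> XG.
(* The largest possible family: all closed subspaces isometric to [G]. *)
pose Fam := [set F : set X | closed_subspace F /\ linearly_isometric_to G F].
have absorb (U C : set X) : linear_subspace U -> gurarii_in U -> countable C ->
    C `<=` U -> exists F, [/\ Fam F, C `<=` F & F `<=` closure U].
  move=> UL UG Cc CU.
  have [u [uiso ucl Cu uU]] :=
    gurarii_isometry_absorbing G_separable (gurarii_inT _ G_gurarii) UL UG Cc CU.
  exists (range u); split=> //; split; last by exists u.
  by split=> //; exact: isometric_embedding_subspace.
have absorbT (C : set X) : countable C -> exists2 F, Fam F & C `<=` F.
  move=> Cc; have [] := absorb setT C _ (gurarii_inT _ XG) Cc (@subsetT _ C).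
    exact/linear_subspaceP.
  by move=> F [? ? _]; exists F.
have sep F : Fam F -> separable_set F.
  by move=> [_]; exact: isometric_copy_separable.
exists Fam; split=> [|F []//]; split=> //.
- by move=> F [].
- apply/seteqP; split=> // x _; have [F FF xF] := absorbT _ (countable1 x).
  by exists F => //; exact: xF.
- move=> F0 F1 /sep[D0 [D0c _ D0F]] /sep[D1 [D1c _ D1F]].
  have [H FH DH] := absorbT _ (countableU D0c D1c); exists H => //.
  have Hcl : closed H by case: FH => -[].
  move=> x [/D0F|/D1F]; apply: closure_sub_closed => // y Dy; apply: DH.
    by left.
  by right.
- move=> F FF Fle.
  have Fmono i j : (i <= j)%N -> F i `<=` F j.
    move=> /subnKC <-; elim: (j - i)%N => [|k IH]; first by rewrite addn0.
    by rewrite addnS; exact: subset_trans IH (Fle _).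
  have /choice[D DP] : forall k, exists D,
      [/\ countable D, D `<=` F k & F k `<=` closure D].
    by move=> k; exact: sep.
  have UL : linear_subspace (\bigcup_n F n).
    apply/linear_subspaceP; split=> [|a u v [i _ ui] [j _ vj]].
      by exists 0%N => //; have [[/linear_subspaceP[]]] := FF 0%N.
    exists (maxn i j) => //.
    have [[/linear_subspaceP[_ +] _] _] := FF (maxn i j); apply.
      exact: Fmono (leq_maxl _ _) _ ui.
    exact: Fmono (leq_maxr _ _) _ vj.
  have UG : gurarii_in (\bigcup_n F n).
    rewrite -(bigcup_image setT F id); apply: directed_gurarii_in G_gurarii _ _.
      move=> _ _ [i _ <-] [j _ <-]; exists (F (maxn i j)).
        by exists (maxn i j).
      move=> x [|]; apply: Fmono; [exact: leq_maxl|exact: leq_maxr].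
    by move=> _ [k _ <-]; case: (FF k).
  have [||H [HF DH HU]] := absorb _ (\bigcup_n D n) UL UG.
  + by apply: bigcup_countable => // k _; case: (DP k).
  + by move=> x [k _ Dx]; exists k => //; case: (DP k) => _ + _; exact.
  rewrite (_ : closure _ = H)//; apply/seteqP; split=> //.
  have Hcl : closed H by case: HF => -[].
  apply: closure_sub_closed => // x [k _]; have [_ _ /[apply]] := DP k.
  by apply: closure_sub_closed => // y Dy; apply: DH; exists k.
Qed.
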